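(* Let $n \ge 2$ be an integer and let $P_n$ be a Pinecone lattice with $n$ maximal elements. Then there exists an algebraic representation $\mathbf{A} = (A, F)$ of $P_n$ such that $A$ has $\frac{n^2+n+2}{2}$ elements and $F$ consists of $\frac{3n^2-n-2}{2}$ functions.
   Context: An algebraic structure is a pair $\mathbf{A} = (A, F)$ where $A$ is a set and $F$ is a set of functions (operations), each of the form $f : A^m \to A$ for some $m \in \mathbb{N} \cup \{0\}$ (the arity $m$ may depend on $f$; a nullary operation, $m=0$, is a distinguished constant in $A$). A subalgebra of $\mathbf{A}$ is a subset $B \subseteq A$ closed under every operation in $F$ (in particular containing every nullary constant), with the restricted operations. The subalgebras of $\mathbf{A}$, ordered by set inclusion, form a lattice $\mathbf{Sub}(\mathbf{A})$. An algebraic representation of a lattice $L$ is an algebraic structure $\mathbf{A}$ such that $\mathbf{Sub}(\mathbf{A})$ is isomorphic to $L$ as a lattice. In a finite lattice with least element $0$ and greatest element $1$, ''maximal elements'' means the elements covered by $1$. A Pinecone lattice $P_n$ is a finite lattice such that: (P1) $P_n$ has exactly $n$ maximal elements $a_1, \dots, a_n$; (P2) for $1 \le i, j \le n$ with $i \ne j$, $a_i \vee a_j = 1$; (P3) for every $b \in P_n \setminus \{1\}$ there is exactly one pair of indices $i, j$ with $1 \le i \le j \le n$ such that $a_i \wedge a_j = b$ (the case $i=j$, giving $b = a_i$, is allowed); (P4) for all $1 \le i, j, k \le n$ with $i \ne k$, $a_i \wedge a_j \ne a_k \wedge a_j$; and for $i < k$, $a_i \wedge a_k = a_i \wedge a_{i+1}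 \wedge \dots \wedge a_k$. *)

(* Defs.v *)
From HB Require Import structures.
From mathcomp Require Import all_boot all_order.
From mathcomp Require Import boolp classical_sets functions cardinality.

Set Implicit Arguments.
Unset Strict Implicit.
Unset Printing Implicit Defensive.

Import Order.TTheory.
Local Open Scope classical_set_scope.

(* The arity is part of an operation. A nullary operation is a function on the
   one-element type [0.-tuple T], that is, a constant of [T]. *)
Record operation (T : Type) := Operation {
  arity : nat;
  op_fun :> arity.-tuple T -> T }.

Record algebra := Algebra {
  carrier :> Type;
  operations : set (operation carrier) }.

Arguments operations : clear implicits.

(* If [A] has no nullary operation, then [set0] is a subalgebra. *)
Definition is_subalgebra (A : algebra) (B : set A) : Prop :=
  forall f, operations A f ->
  forall t : (arity f).-tuple A, (forall i, B (tnth t i)) -> B (f t).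

Record subalgebra (A : algebra) := Subalgebra {
  subalgebra_set :> set A;
  _ : `[< is_subalgebra subalgebra_set >] }.

HB.instance Definition _ (A : algebra) := [isSub for @subalgebra_set A].
HB.instance Definition _ (A : algebra) := [Choice of subalgebra A by <:].
HB.instance Definition _ (A : algebra) :=
  [SubChoice_isSubPOrder of subalgebra A by <: with set_display].

Section SubalgebraLattice.
Variable A : algebra.
Implicit Types B C D : subalgebra A.

Lemma subalgebra_leE B C : (B <= C)%O = `[< B `<=` C >].
Proof. by []. Qed.

Lemma subalgebraP B : is_subalgebra B.
Proof. by case: B => B /= /asboolP. Qed.

Lemma subalgebra_meet_subproof B C : `[< is_subalgebra (B `&` C) >].
Proof.
apply/asboolP => f Ff t BCt.
by split; apply: subalgebraP => // i; case: (BCt i).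
Qed.

Definition subalgebra_meet B C := Subalgebra (subalgebra_meet_subproof B C).

Lemma subalgebra_join_subproof B C :
  `[< is_subalgebra (smallest (@is_subalgebra A) (B `|` C)) >].
Proof.
apply/asboolP => f Ff t BCt D /= [Dsub BCD].
by apply: (Dsub f) => // i; apply: BCt.
Qed.

Definition subalgebra_join B C := Subalgebra (subalgebra_join_subproof B C).

Lemma subalgebra_meetP B C D :
  (B <= subalgebra_meet C D)%O = (B <= C)%O && (B <= D)%O.
Proof.
rewrite !subalgebra_leE.
apply/asboolP/andP => [BCD|[/asboolP BC /asboolP BD] x Bx].
  by split; apply/asboolP => x Bx; case: (BCD x Bx).
by split; [exact: BC | exact: BD].
Qed.

Lemma subalgebra_joinP B C D :
  (subalgebra_join B C <= D)%O = (B <= D)%O && (C <= D)%O.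
Proof.
rewrite !subalgebra_leE; apply/asboolP/andP => [BCD|[/asboolP BD /asboolP CD]].
  by split; apply/asboolP => x Xx; apply: (BCD x); apply: sub_gen_smallest;
    [exact: or_introl Xx | exact: or_intror Xx].
by apply: smallest_sub => [|x []]; [exact: subalgebraP|exact: BD|exact: CD].
Qed.

HB.instance Definition _ :=
  Order.POrder_MeetJoin_isLattice.Build set_display (subalgebra A)
    subalgebra_meetP subalgebra_joinP.

End SubalgebraLattice.

Definition algebraic_representation d (L : latticeType d) (A : algebra) :=
  exists f : {lmorphism L -> subalgebra A}, bijective f.

Definition covered_by d (L : porderType d) (x y : L) : Prop :=
  (x < y)%O /\ ~ exists z : L, (x < z < y)%O.

(* The indices run over 0, ..., n - 1 instead of 1, ..., n. *)
Record pinecone_labelling d (L : finTBLatticeType d) (n : nat)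
    (a : 'I_n -> L) : Prop := PineconeLabelling {
  pinecone_inj : injective a;
  pinecone_maximal : forall x : L,
    covered_by x \top%O <-> exists i, a i = x;
  pinecone_join : forall i j, i != j -> (a i `|` a j)%O = \top%O;
  pinecone_meet : forall b : L, b != \top%O ->
    exists! ij : 'I_n * 'I_n,
      (ij.1 <= ij.2)%N /\ (a ij.1 `&` a ij.2)%O = b;
  pinecone_meet_neq : forall i j k, i != k ->
    (a i `&` a j)%O != (a k `&` a j)%O;
  pinecone_meet_interval : forall i k : 'I_n, (i < k)%N ->
    (a i `&` a k)%O = (\meet_(j < n | (i <= j <= k)%N) a j)%O }.

Definition pinecone d (L : finTBLatticeType d) (n : nat) : Prop :=
  exists a : 'I_n -> L, pinecone_labelling a.

(* Main.v *)
Require Import Defs.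
From HB Require Import structures.
From mathcomp Require Import all_boot all_order.
From mathcomp Require Import boolp classical_sets functions cardinality.
From mathcomp Require Import zify.

(** A finite lattice [L] is represented on its own carrier by making the
    subalgebras exactly the ideals: every ideal of a finite lattice is principal,
    so [x |-> {y | y <= x}] is then an isomorphism from [L] onto the lattice of
    subalgebras. A subset of [L] is an ideal as soon as it contains the bottom,
    is closed under binary joins, and is closed under meets with a family of
    elements whose pairwise meets exhaust [L]: such a set is closed under
    [x |-> x `&` y] for every [y], hence is downward closed.

    In a pinecone every element is [1] or [a_i `&` a_j], so the family
    [a_1, ..., a_n, 1] suffices. The bottom, the [n] meets [x `&` a_i] and the
    join require at most [n + 2] operations, and [n + 2 <= (3n^2 - n - 2)/2] for
    [n >= 2]. To reach the prescribed number exactly, these operations all take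
    the shape [(t_1 `|` ... `|` t_k) `&` c_k], one for each arity [k] below that
    number ([clipped_join]); operations of distinct arities are distinct, and
    every ideal is closed under all of them ([principal_ideal_subproof]).

    The carrier has the right size because the elements other than [1] correspond
    to the pairs [i <= j], of which there are [n(n+1)/2] ([card_pinecone]). *)

Import Order.TTheory.
Local Open Scope classical_set_scope.
Local Open Scope card_scope.

(** * Lattices represented by their principal ideals *)

Lemma order_iso_lmorphism d (L : latticeType d) d' (M : latticeType d')
    (f : L -> M) : bijective f -> {mono f : x y / (x <= y)%O} ->
  exists g : {lmorphism L -> M}, bijective g.
Proof.
move=> fbij fmono; have [h fK hK] := fbij.
have hmono : {mono h : x y / (x <= y)%O} by move=> x y; rewrite -fmono !hK.
have fhomo : {homo f : x y / (x <= y)%O} by move=> x y; rewrite fmono.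
have fI : Order.meet_morphism f.
  move=> x y; apply/le_anti; rewrite lexI !fmono leIl leIr /=.
  by rewrite -[X in (X <= _)%O]hK fmono lexI -!fmono hK leIl leIr.
have fU : Order.join_morphism f.
  move=> x y; apply/le_anti; rewrite leUx !fmono leUl leUr andbT /=.
  by rewrite -[X in (_ <= X)%O]hK fmono leUx -!fmono hK leUl leUr.
pose fO := Order.isOrderMorphism.Build _ _ _ _ f fhomo.
pose fM := Order.isMeetLatticeMorphism.Build _ _ _ _ f fI.
pose fJ := Order.isJoinLatticeMorphism.Build _ _ _ _ f fU.
pose g : {lmorphism L -> M} := HB.pack f fO fM fJ.
by exists g.
Qed.

Lemma joins_const d (L : bJoinSemilatticeType d) k (x : L) :
  (\join_(i < k.+1) x)%O = x.
Proof.
apply/le_anti/andP; split; first exact/joinsP.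
exact: (@joins_min _ _ _ (ord0 : 'I_k.+1)).
Qed.

Section IdealAlgebra.
Context {d : Order.disp_t} {L : finTBLatticeType d}.
Variables (c : nat -> L) (N : nat).

(** Arity [0] gives the bottom, arity [1] the map [x |-> x `&` c 1], and any
    arity [k >= 2] with [c k = \top] gives the binary join on tuples with
    repeated entries. *)
Definition clipped_join (k : nat) : operation L :=
  Operation (fun t : k.-tuple L => ((\join_(i < k) tnth t i) `&` c k)%O).

Definition ideal_algebra : algebra := Algebra (clipped_join @` `I_N).

Lemma card_operations_ideal_algebra : operations ideal_algebra #= `I_N.
Proof. by apply: inj_card_eq => j k _ _ /(congr1 (@arity _)). Qed.

(** Clipping only lowers a join, so the operations preserve every upper bound of
    their arguments: raising [N] never loses a subalgebra. *)
Lemma principal_ideal_subproof (x : L) :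
  `[< @is_subalgebra ideal_algebra [set y | (y <= x)%O] >].
Proof.
apply/asboolP => _ [k _ <-] t tx /=.
by apply: leIxl; apply/joinsP => i _; exact: tx.
Qed.

Definition principal_ideal (x : L) : subalgebra ideal_algebra :=
  Subalgebra (principal_ideal_subproof x).

Lemma principal_ideal_mono : {mono principal_ideal : x y / (x <= y)%O}.
Proof.
move=> x y; rewrite subalgebra_leE; apply/asboolP/idP => [|xy z /= zx].
  by move/(_ x); apply; exact: lexx.
exact: le_trans xy.
Qed.

Variable k_join : nat.
Hypotheses (k_join_bound : (2 <= k_join < N)%N) (c_join : c k_join = \top%O).
Hypothesis meet_cover : forall y : L, exists i j,
  [/\ (0 < i < N)%N, (0 < j < N)%N & y = (c i `&` c j)%O].

Section ClosedSet.
Variable B : set L.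
Hypothesis B_closed : @is_subalgebra ideal_algebra B.

Lemma closed_clipped_join k (t : k.-tuple L) : (k < N)%N ->
  (forall i, B (tnth t i)) -> B ((\join_(i < k) tnth t i) `&` c k)%O.
Proof. by move=> kN Bt; apply: (B_closed (clipped_join k)) => //; exists k. Qed.

Lemma closed_bot : B \bot%O.
Proof.
have /(_ _ _)/= := closed_clipped_join 0 [tuple].
by rewrite big_ord0 meet0x; apply=> [|[]//]; lia.
Qed.

Lemma closed_join x y : B x -> B y -> B (x `|` y)%O.
Proof.
case: k_join k_join_bound c_join => // k /andP[k_gt0 kN] ck Bx By.
have := closed_clipped_join _ [tuple of x :: nseq k y] kN.
have -> : (\join_(i < k.+1) tnth [tuple of x :: nseq k y] i = x `|` y)%O.
  rewrite big_ord_recl tnth0; congr (_ `|` _)%O.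
  (* [x] is joined with [k >= 1] copies of [y]. *)
  have E i : tnth [tuple of x :: nseq k y] (lift ord0 i) = y.
    by rewrite (tnth_nth x) /= nth_nseq ltn_ord.
  under eq_bigr do rewrite E.
  by case: {E} k k_gt0 {kN ck} => // k _; exact: joins_const.
rewrite ck meetx1; apply=> i; rewrite (tnth_nth x).
case: i => -[|i] //= ik; rewrite nth_nseq; case: ifP => // _.
Qed.

Lemma closed_meet_cut x k : (0 < k < N)%N -> B x -> B (x `&` c k)%O.
Proof.
case: k => // k kN Bx; have := closed_clipped_join _ (nseq_tuple k.+1 x) kN.
have E i : tnth (nseq_tuple k.+1 x) i = x.
  by rewrite (tnth_nth x) /= -[x :: _]/(nseq k.+1 x) nth_nseq ltn_ord.
have -> : (\join_(i < k.+1) tnth (nseq_tuple k.+1 x) i = x)%O.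
  by under eq_bigr do rewrite E; exact: joins_const.
by apply=> i; rewrite E.
Qed.

(** Writing [y] as a meet of two cutting elements, [y = x `&` y] is reached from
    [x] by two cuts. *)
Lemma closed_le x y : (y <= x)%O -> B x -> B y.
Proof.
move=> /meet_idPr <- Bx; have [i [j [iN jN ->]]] := meet_cover y.
by rewrite meetA; apply: closed_meet_cut => //; exact: closed_meet_cut.
Qed.

(** The join of all elements of [B] lies in [B] because the join is finite; this
    covers an empty index set too, since the nullary operation excludes
    [B = set0]. *)
Lemma closed_setE : B = [set y | (y <= \join_(x : L | `[< B x >]) x)%O].
Proof.
apply/seteqP; split=> [x Bx|x xle].
  by apply: joins_sup; exact/asboolP.
apply: (closed_le _ _ xle).
by elim/big_ind: _ => [||x' /asboolP //]; [exact: closed_bot|exact: closed_join].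
Qed.

End ClosedSet.

Lemma ideal_algebra_representation : algebraic_representation L ideal_algebra.
Proof.
apply: (@order_iso_lmorphism _ _ _ _ principal_ideal); last first.
  exact: principal_ideal_mono.
pose gen (B : subalgebra ideal_algebra) : L :=
  (\join_(x : L | `[< (B : set L) x >]) x)%O.
have genK : cancel gen principal_ideal
  by move=> B; apply/val_inj; rewrite -[LHS]closed_setE //; exact: subalgebraP.
exists gen => // x; apply/le_anti.
by rewrite -!principal_ideal_mono genK lexx.
Qed.

End IdealAlgebra.

(** * Counting the elements of a pinecone *)

Lemma card_setT_fintype (T : finType) : [set: T] #= `I_#|T|.
Proof.
have -> : [set: T] = @enum_val T T @` [set: 'I_#|T|].
  by apply/seteqP; split=> // x _; exists (enum_rank x); rewrite ?enum_rankK.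
apply: card_eq_trans (card_esym card_II).
by apply: inj_card_eq => i j _ _; exact: enum_val_inj.
Qed.

(** Counted by the larger index [j], which leaves [j + 1] choices for [i]. *)
Lemma card_ord_pairs_leq n :
  #|[set ij : 'I_n * 'I_n | (ij.1 <= ij.2)%N]%SET| = 'C(n.+1, 2).
Proof.
rewrite -bin2_sum big_nat_recl //= add0n big_mkord.
rewrite -sum1dep_card.
have -> : (\sum_(ij : 'I_n * 'I_n | ij.1 <= ij.2) 1 =
           \sum_(i < n) \sum_(j < n | i <= j) 1)%N by rewrite pair_big_dep.
rewrite (exchange_big_dep xpredT) //=; apply: eq_bigr => j _.
rewrite sum1dep_card -[RHS](card_ord j.+1).
have widen_inj : injective (widen_ord (ltn_ord j)).
  by move=> u v /(congr1 val) /= /val_inj.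
rewrite -(card_imset _ widen_inj); apply: eq_card => i.
rewrite !inE; apply/idP/imsetP => [ij|[k _ ->]]; last exact: (ltn_ord k).
by exists (Ordinal (ij : (i < j.+1)%N)) => //; exact: val_inj.
Qed.

(** Unique representability by pairwise meets makes [(i, j) |-> a_i `&` a_j] a
    bijection from the pairs [i <= j] onto the elements other than [1]; it avoids
    [1] because each [a_i] is a coatom. *)
Lemma card_pinecone d (P : finTBLatticeType d) n :
  pinecone P n -> #|P| = 'C(n.+1, 2).+1.
Proof.
case=> a aP; rewrite -cardsT (cardsD1 (\top%O : P)) finset.in_setT add1n.
congr _.+1; rewrite -card_ord_pairs_leq.
pose m (ij : 'I_n * 'I_n) := (a ij.1 `&` a ij.2)%O.
have m_neq1 ij : m ij != \top%O.
  have [_ /(_ (ex_intro _ ij.1 erefl))[a_lt1 _]] := pinecone_maximal aP (a ij.1).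
  by rewrite -ltx1; apply: le_lt_trans a_lt1; exact: leIl.
have m_inj : {in [set ij : 'I_n * 'I_n | (ij.1 <= ij.2)%N]%SET &, injective m}.
  move=> u v; rewrite !inE => u_le v_le uv.
  have [w [_ w_uniq]] := pinecone_meet aP (m_neq1 u).
  by rewrite -(w_uniq u) // -(w_uniq v).
rewrite -(card_in_imset m_inj); apply: eq_card => b; rewrite !inE andbT.
apply/idP/imsetP => [b_neq1|[ij _ ->]]; last exact: m_neq1.
have [ij [[ij_le mij] _]] := pinecone_meet aP b_neq1.
by exists ij; rewrite ?inE.
Qed.

(** * The representation of a pinecone *)

Theorem proposition5 (d : Order.disp_t) (P : finTBLatticeType d) (n : nat)
    (n_ge2 : (2 <= n)%N) (pineconeP : pinecone P n) :
  exists A : algebra,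
    [/\ algebraic_representation P A,
        [set: A] #= `I_((n ^ 2 + n + 2) %/ 2)
      & operations A #= `I_((3 * n ^ 2 - n - 2) %/ 2)].
Proof.
have cardP := card_pinecone _ _ _ pineconeP.
have [a aP] := pineconeP.
pose N := ((3 * n ^ 2 - n - 2) %/ 2)%N.
have N_ge : (n + 2 <= N)%N by rewrite /N; nia.
(* [c] lists [a_0, a_0, a_1, ..., a_(n-1), 1, 1, ...]: the operation of arity
   [i + 1] cuts by [a_i], that of arity [n + 1] is an uncut join, and [c 0] only
   meets the bottom element. *)
pose c k : P := oapp a \top%O (insub k.-1).
have c_succ (i : 'I_n) : c i.+1 = a i by rewrite /c /= valK.
have c_top : c n.+1 = \top%O by rewrite /c /= insubF ?ltnn.
exists (ideal_algebra c N); split; last exact: card_operations_ideal_algebra.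
- apply: (@ideal_algebra_representation _ _ _ _ n.+1) => // [|y]; first lia.
  have [->|/(pinecone_meet aP)[[i j] [[_ /= <-] _]]] := eqVneq y \top%O.
    by exists n.+1, n.+1; rewrite c_top meetxx; split=> //; lia.
  exists i.+1, j.+1; rewrite !c_succ; split=> //.
    by have := ltn_ord i; lia.
  by have := ltn_ord j; lia.
- have -> : ((n ^ 2 + n + 2) %/ 2 = #|P|)%N.
    by rewrite cardP bin2 /=; nia.
  exact: card_setT_fintype.
Qed.
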